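(* Let $\mathscr{A}$ be any set of proper multiplications on $\mathbb{Z}^d$. There exists $A\subseteq\mathbb{Z}^d_{\neq0}$ such that: (I) for every $\circledast\in\mathscr{A}$, $A$ is thick in the semigroup $(\mathbb{Z}^d_{\neq0},\circledast)$; (II) for every proper multiplication $\odot$ on $\mathbb{Z}^d$ which is not aligned with any multiplication in $\mathscr{A}$, $A$ is not piecewise syndetic in $(\mathbb{Z}^d_{\neq0},\odot)$ and, if $(\mathbb{Z}^d_{\neq0},\odot)$ is left amenable, $d^*_\odot(A)=0$.
   Context: A proper multiplication on $\mathbb{Z}^d$ is a binary operation $\circledast:\mathbb{Z}^d\times\mathbb{Z}^d\to\mathbb{Z}^d$ making $(\mathbb{Z}^d,+)$ an associative (not necessarily commutative or unital) ring without zero divisors; $\mathbb{Z}^d_{\neq0}=\mathbb{Z}^d\setminus\{0\}$. Two proper multiplications $\circledast,\odot$ are aligned if there exist $v,w\in\mathbb{Z}^d_{\neq0}$ with $x\circledast v\circledast y=x\odot w\odot y$ for all $x,y\in\mathbb{Z}^d$. In a semigroup $(S,\cdot)$, with $s^{-1}\cdot A=\{t: s\cdot t\in A\}$: $A$ is thick if for every finite $F\subseteq S$ there is $x\in S$ with $F\cdot x\subseteq A$; piecewise syndetic if $s_1^{-1}\cdot A\cup\dots\cup s_k^{-1}\cdot A$ is thick for some $s_1,\dots,s_k\in S$. A semigroup is left amenable if the space of bounded complex functions on it admits a left-translation-invariant mean. $d^*_\odot(A)=\sup\{\alpha\ge0:\forall\text{ finite }F\subseteq\mathbb{Z}^d_{\neq0}\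 \exists s\in\mathbb{Z}^d_{\neq0},\ |(F\odot s)\cap A|\ge\alpha|F|\}$. *)

(* Defs.v *)
From mathcomp Require Import all_boot all_order all_algebra.
From mathcomp Require Import finmap.
From mathcomp Require Import all_classical all_reals.
From mathcomp Require Import complex.

Set Implicit Arguments.
Unset Strict Implicit.
Unset Printing Implicit Defensive.

Import Order.TTheory GRing.Theory Num.Theory.
Local Open Scope fset_scope.
Local Open Scope classical_set_scope.
Local Open Scope ring_scope.

Section Semigroup.
Variables (S : choiceType) (op : S -> S -> S).

Definition lquot (s : S) (A : set S) : set S := [set t | A (op s t)].

Definition thick (A : set S) : Prop :=
  forall F : {fset S}, exists x : S, forall f, f \in F -> A (op f x).

Definition piecewise_syndetic (A : set S) : Prop :=
  exists r : seq S, thick (\bigcup_(s in [set` r]) lquot s A).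

Variable R : realType.

Definition bounded_cfun (f : S -> R[i]) : Prop :=
  exists M : R[i], forall x, `|f x| <= M.

(* A mean is a positive normalized linear functional on the bounded functions;
   the values of [m] on unbounded functions are irrelevant.  In the order of
   [R[i]], [0 <= z] says that z is real and nonnegative. *)
Definition is_mean (m : (S -> R[i]) -> R[i]) : Prop :=
  [/\ forall (a : R[i]) (f g : S -> R[i]), bounded_cfun f -> bounded_cfun g ->
        m (fun x => a * f x + g x) = a * m f + m g,
      forall f : S -> R[i], bounded_cfun f -> (forall x, 0 <= f x) -> 0 <= m f
    & m (fun=> 1) = 1].

Definition left_invariant (m : (S -> R[i]) -> R[i]) : Prop :=
  forall (s : S) (f : S -> R[i]), bounded_cfun f ->
    m (fun t => f (op s t)) = m f.

Definition left_amenable : Prop :=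
  exists m : (S -> R[i]) -> R[i], is_mean m /\ left_invariant m.

Definition upper_density (A : set S) : R :=
  sup [set a : R | 0 <= a /\
    forall F : {fset S}, exists s : S,
      a * #|` F|%:R
        <= #|` [fset y in [fset op f s | f in F] | y \in A]|%:R].

End Semigroup.

Section ProperMultiplication.
Variable d : nat.

Record proper_mult := ProperMult {
  pmul :> 'rV[int]_d -> 'rV[int]_d -> 'rV[int]_d;
  pmulA : associative pmul;
  pmulDl : left_distributive pmul +%R;
  pmulDr : right_distributive pmul +%R;
  pmul_eq0 : forall x y, pmul x y = 0 -> x = 0 \/ y = 0
}.

Definition aligned (p q : proper_mult) : Prop :=
  exists v w : 'rV[int]_d, [/\ v != 0, w != 0 &
    forall x y, p (p x v) y = q (q x w) y].

Definition nzvec := {x : 'rV[int]_d | x != 0}.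

Lemma pmul_neq0 (p : proper_mult) (x y : nzvec) : p (val x) (val y) != 0.
Proof.
by apply/eqP => /pmul_eq0 [] h; [have := valP x | have := valP y];
  rewrite /= h eqxx.
Qed.

Definition nzmul (p : proper_mult) (x y : nzvec) : nzvec :=
  exist _ (p (val x) (val y)) (pmul_neq0 p x y).

Lemma nzmulA (p : proper_mult) : associative (nzmul p).
Proof. by move=> x y z; apply: val_inj; rewrite /= pmulA. Qed.

End ProperMultiplication.

(* Main.v *)
From HB Require Import structures.
Require Import Defs.
From mathcomp Require Import all_boot all_order all_algebra.
From mathcomp Require Import finmap.
From mathcomp Require Import all_classical all_reals.

Set Implicit Arguments.
Unset Strict Implicit.
Unset Printing Implicit Defensive.

Import Order.TTheory GRing.Theory Num.Theory.
Local Open Scope fset_scope.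
Local Open Scope classical_set_scope.
Local Open Scope ring_scope.

(** A multiplication is determined by its structure constants, so the pairs
    (F_n, p_n) of a finite list of nonzero vectors and a multiplication in the
    given family can be enumerated. Let A be the union of the blocks F_n p_n
    x_n, where x_n is chosen on a moment curve, off finitely many points at
    each stage; thickness is immediate.

    Let q be a multiplication, and let g0 q s and g q s both lie in A, past
    the first blocks. A good choice of x_n forces them into the same block n,
    and forces the linear relation satisfied by x_n to hold identically: over
    Q, left multiplication by g g0^-1 in q is then a left multiplication of
    p_n. For fixed g0 the vectors g with this property form a saturated
    submodule of Z^d. If it is everything, then q and p_n have the same left
    multiplications up to scaling, hence associate with each other, and q is
    aligned with p_n. Otherwise it contains fewer than d points of the moment
    curve. So, if q is not aligned with any p_n, the translates of a long
    piece of the moment curve meet A, up to a fixed finite set, in fewer than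
    d points; disjoint dilates of this piece absorb the finite set. This gives
    both that A is not piecewise syndetic and that its density vanishes.

    Division in (Q^d, p) is done in Z^d up to an integer factor, by the
    adjugate matrix of a left or right multiplication. *)

Definition saturated_submod (R : pzRingType) (V : lmodType R) (P : set V) :
    Prop :=
  [/\ P 0,
      forall a u v, P u -> P v -> P (a *: u + v)
    & forall a u, a != 0 -> P (a *: u) -> P u].

Lemma saturated_submod_preim (R : pzRingType) (U V : lmodType R)
    (f : {linear U -> V}) (P : set V) :
  saturated_submod P -> saturated_submod (f @^-1` P).
Proof.
move=> [P0 PD Psat]; split=> [|a u v|a u a_neq0] /=.
- by rewrite linear0.
- by rewrite linearP; apply: PD.
- by rewrite linearZ; apply: Psat.
Qed.

Section AdjugateInversion.
Variables (R : idomainType) (n : nat).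
Local Notation V := 'rV[R]_n.

Lemma mulmx_adjl (u : V) (A : 'M[R]_n) : u *m \adj A *m A = \det A *: u.
Proof. by rewrite -mulmxA mul_adj_mx mul_mx_scalar. Qed.

Lemma saturated_submod_full (P : set V) (A : 'M[R]_n) :
    saturated_submod P -> \det A != 0 -> (forall i, P (row i A)) ->
  forall u, P u.
Proof.
move=> [P0 PD Psat] detA PA u; apply: (Psat (\det A)) => //.
rewrite -mulmx_adjl mulmx_sum_row; apply: big_ind => // [v w Pv Pw|i _].
  by rewrite -[v]scale1r; apply: PD.
by rewrite -[_ *: _]addr0; apply: PD.
Qed.

Lemma linear_inj_surj_scale (f : {linear V -> V}) : injective f ->
  forall v, exists a u, a != 0 /\ f u = a *: v.
Proof.
move=> f_inj v; exists (\det (lin1_mx f)), (v *m \adj (lin1_mx f)); split.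
  apply/det0P => -[u u_neq0]; rewrite mul_rV_lin1 -(linear0 f) => /f_inj u0.
  by rewrite u0 eqxx in u_neq0.
by rewrite -mul_rV_lin1 mulmx_adjl.
Qed.

End AdjugateInversion.

Lemma additive_linear_int (U W : lmodType int) (f : U -> W) :
  {morph f : x y / x + y} -> linear f.
Proof.
move=> fD a x y; rewrite fD; congr (_ + _).
have f0 : f 0 = 0 by apply: (addrI (f 0)); rewrite -fD !addr0.
pose g : {additive U -> W} := HB.pack f
  (GRing.isNmodMorphism.Build U W f (conj f0 fD)).
exact: (raddfZ_int g).
Qed.

Section ProperMultiplications.
Variable d : nat.
Local Notation V := 'rV[int]_d.
Implicit Types (p q : proper_mult d) (u v w x y z : V).

Lemma pmul_is_bilinear p : bilinear_for
  (GRing.Scale.Law.clone _ _ *:%R _) (GRing.Scale.Law.clone _ _ *:%R _) (pmul p).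
Proof.
by split=> z; apply: additive_linear_int => x y; [apply: pmulDl | apply: pmulDr].
Qed.

HB.instance Definition _ p :=
  bilinear_isBilinear.Build int V V V *:%R *:%R (pmul p) (pmul_is_bilinear p).

HB.instance Definition _ p x :=
  GRing.Linear.copy (pmul p x) ((pmul p : {bilinear V -> V -> V}) x).

Lemma pmulZl p a x y : p (a *: x) y = a *: p x y.
Proof. exact: linearZl_LR. Qed.

Lemma pmulZr p a x y : p x (a *: y) = a *: p x y.
Proof. exact: linearZr_LR. Qed.

Lemma pmulf_eq0 p x y : (p x y == 0) = (x == 0) || (y == 0).
Proof.
apply/eqP/orP => [/pmul_eq0[]->|[]/eqP->].
- by left.
- by right.
- by rewrite linear0l.
- by rewrite linear0r.
Qed.

Lemma pmulI p x : x != 0 -> injective (p x).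
Proof.
move=> x_neq0 y z /eqP; rewrite -subr_eq0 -linearBr pmulf_eq0 (negPf x_neq0).
by rewrite subr_eq0 => /eqP.
Qed.

Lemma pmulIr p y : y != 0 -> injective (p^~ y).
Proof.
move=> y_neq0 x z /eqP; rewrite -subr_eq0 -linearBl pmulf_eq0 (negPf y_neq0).
by rewrite orbF subr_eq0 => /eqP.
Qed.

Lemma pmul_ldiv p x y : x != 0 -> exists a z, a != 0 /\ p x z = a *: y.
Proof. by move=> x_neq0; apply: linear_inj_surj_scale (pmulI x_neq0) y. Qed.

Lemma pmul_rdiv p x y : x != 0 -> exists a z, a != 0 /\ p z x = a *: y.
Proof.
move=> x_neq0.
exact: (linear_inj_surj_scale (f := applyr p x) (pmulIr x_neq0)).
Qed.

(* Over Q, left multiplication by [y x^-1] in [q] is left multiplication by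
   [a^-1 c] in [p]. *)
Definition ratio_translation q p x y : Prop :=
  exists a c, a != 0 /\ forall z, a *: q y z = p c (q x z).

Lemma ratio_translation_saturated q p x :
  saturated_submod (ratio_translation q p x).
Proof.
split=> [|b u v [a [c [a_neq0 uE]]] [a' [c' [a'_neq0 vE]]]|].
- by exists 1, 0; split=> // z; rewrite !linear0l scaler0.
- exists (a * a'), ((a' * b) *: c + a *: c'); split=> [|z].
    by rewrite mulf_neq0.
  rewrite !pmulDl !pmulZl -uE -vE scalerDr !scalerA.
  by congr (_ *: _ + _); rewrite [RHS]mulrC mulrA.
- move=> b u b_neq0 [a [c [a_neq0 uE]]]; exists (a * b), c.
  by split=> [|z]; rewrite ?mulf_neq0 // -uE pmulZl scalerA.
Qed.

Definition left_translations_embed q p : Prop :=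
  forall x, exists a c, a != 0 /\ forall z, a *: q x z = p c z.

Lemma ratio_translation_embed q p x : x != 0 ->
  (forall y, ratio_translation q p x y) -> left_translations_embed q p.
Proof.
move=> x_neq0 ratio y; have [a [c [a_neq0 yE]]] := ratio (q y x).
exists a, c; split=> // z; have [b [w [b_neq0 zE]]] := pmul_ldiv q z x_neq0.
have := yE w; rewrite -pmulA zE !pmulZr scalerA mulrC -scalerA.
exact: scalemx_inj.
Qed.

Lemma left_translations_embed_sym q p u : u != 0 ->
  left_translations_embed q p -> left_translations_embed p q.
Proof.
move=> u_neq0 emb x; have [b [y [b_neq0 yE]]] := pmul_rdiv q (p x u) u_neq0.
have [a [c [a_neq0 aE]]] := emb y.
have cE : c = (a * b) *: x.
  by apply: (pmulIr (p := p) u_neq0); rewrite /= -aE yE scalerA pmulZl.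
exists b, y; split=> // z; apply: (scalemx_inj a_neq0).
by rewrite scalerA aE cE pmulZl.
Qed.

Lemma left_translations_embed_mulA q p : left_translations_embed p q ->
  forall x y z, q (p x y) z = p x (q y z).
Proof.
move=> emb x y z; have [a [c [a_neq0 xE]]] := emb x.
by apply: (scalemx_inj a_neq0); rewrite xE pmulA -xE pmulZl.
Qed.

(* Since [q] and [p] associate with each other and every vector has a multiple of
   the form [p y u], right multiplication by [u] in [q] is, up to scaling, right
   multiplication by some [v] in [p]. *)
Lemma left_translations_embed_aligned q p u : u != 0 ->
  left_translations_embed q p -> aligned q p.
Proof.
move=> u_neq0 emb.
have mulA := left_translations_embed_mulA (left_translations_embed_sym u_neq0 emb).
have [a [v [a_neq0 vE]]] := pmul_ldiv p (q u u) u_neq0.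
have right_u x : a *: q x u = p x v.
  have [b [y [b_neq0 yE]]] := pmul_rdiv p x u_neq0.
  have : a *: q (p y u) u = p (p y u) v by rewrite mulA -pmulZr -vE pmulA.
  by rewrite yE !pmulZl scalerA mulrC -scalerA; apply: scalemx_inj.
have [b [w [b_neq0 wE]]] := emb v.
pose v' := (a * b) *: u.
have v'_neq0 : v' != 0 by rewrite scalemx_eq0 negb_or mulf_neq0.
have sandwich x y : q (q x v') y = p (p x w) y.
  rewrite pmulZr [a * b]mulrC -scalerA right_u !pmulZl mulA.
  by rewrite -pmulZr wE pmulA.
have quvu_neq0 : q (q u v') u != 0 by rewrite !pmulf_eq0 !negb_or u_neq0 v'_neq0.
exists v', w; split=> //; apply: contra_neq quvu_neq0 => w0.
by rewrite sandwich w0 linear0r linear0l.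
Qed.

(* Over Q, the vectors [z] such that [y0 z] and [y z] in [p] are [x0 s] and
   [x s] in [q], for a common [s]. *)
Definition comparable_products q p x0 x y0 y : set V :=
  [set z | exists a s, [/\ a != 0, q x0 s = a *: p y0 z & q x s = a *: p y z]].

Lemma comparable_products_saturated q p x0 x y0 y :
  saturated_submod (comparable_products q p x0 x y0 y).
Proof.
split=> [|b z z' [a [s [a_neq0 s0E sE]]] [a' [s' [a'_neq0 s'0E s'E]]]|].
- by exists 1, 0; rewrite !linear0r !scaler0.
- exists (a * a'), ((a' * b) *: s + a *: s').
  split; rewrite ?mulf_neq0 // !pmulDr !pmulZr scalerDr ?(s0E, sE) ?(s'0E, s'E);
    by rewrite !scalerA [a' * b * a]mulrC mulrA.
- move=> b z b_neq0 [a [s [a_neq0 s0E sE]]]; exists (a * b), s.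
  by rewrite mulf_neq0 // s0E sE !pmulZr !scalerA.
Qed.

Lemma comparable_products_ratio q p x0 x y0 y : x0 != 0 -> y0 != 0 ->
  (forall z, comparable_products q p x0 x y0 y z) -> ratio_translation q p x0 x.
Proof.
move=> x0_neq0 y0_neq0 comp; have [b [c [b_neq0 yE]]] := pmul_rdiv p y y0_neq0.
exists b, c; split=> // s.
have [a [z [a_neq0 zE]]] := pmul_ldiv p (q x0 s) y0_neq0.
have [a' [s' [a'_neq0 s'0E s'E]]] := comp z.
have sE : s' = (a' * a) *: s.
  by apply: (pmulI (p := q) x0_neq0); rewrite s'0E zE pmulZr scalerA.
have pcE : a *: p c (q x0 s) = b *: p y z by rewrite -pmulZr -zE pmulA yE pmulZl.
have pyE : a' *: p y z = (a' * a) *: q x s by rewrite -s'E sE pmulZr.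
apply: (scalemx_inj (mulf_neq0 a'_neq0 a_neq0)).
rewrite -[RHS]scalerA pcE [RHS]scalerA [a' * b]mulrC -[RHS]scalerA pyE.
by rewrite !scalerA [b * _]mulrC.
Qed.

Definition structure_constants p : {ffun 'I_d * 'I_d -> V} :=
  [ffun ij => p 'e_ij.1 'e_ij.2].

Lemma pmul_structure_constants p x y :
  p x y = \sum_i \sum_j (x 0 i * y 0 j) *: structure_constants p (i, j).
Proof.
rewrite {1}[x]row_sum_delta linear_sumlz; apply: eq_bigr => i _.
rewrite /= pmulZl {1}[y]row_sum_delta linear_sumr scaler_sumr.
by apply: eq_bigr => j _; rewrite /= pmulZr scalerA ffunE.
Qed.

Lemma structure_constants_inj : injective structure_constants.
Proof.
move=> p q pq; have : pmul p = pmul q.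
  by apply/funext => x; apply/funext => y; rewrite !pmul_structure_constants pq.
case: p q {pq} => [m a1 a2 a3 a4] [m' b1 b2 b3 b4] /= mm'.
by subst m'; congr ProperMult; apply: Prop_irrelevance.
Qed.

End ProperMultiplications.

Lemma injective_pcancel (T U : Type) (f : T -> U) :
  injective f -> exists g, pcancel f g.
Proof.
move=> f_inj; suff /choice[g gP] u : exists o, forall x, f x = u -> o = Some x.
  by exists g => x; apply: gP.
have [[x <-]|not_image] := pselect (exists x, f x = u).
  by exists (Some x) => y /f_inj ->.
by exists None => x fx; case: not_image; exists x.
Qed.

Definition of_structure_constants (d : nat) :
    {ffun 'I_d * 'I_d -> 'rV[int]_d} -> option (proper_mult d) :=
  sval (cid (injective_pcancel (@structure_constants_inj d))).

Lemma structure_constantsK (d : nat) :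
  pcancel (@structure_constants d) (@of_structure_constants d).
Proof. exact: svalP (cid (injective_pcancel (@structure_constants_inj d))). Qed.

HB.instance Definition _ (d : nat) :=
  Countable.copy (proper_mult d) (pcan_type (@structure_constantsK d)).

Section NonzeroVectors.
Variable d : nat.
Implicit Types (p : proper_mult d) (x y : nzvec d).

Lemma nzmulI p : right_injective (nzmul p).
Proof. by move=> x y z /(congr1 val)/(pmulI (valP x)) yz; apply: val_inj. Qed.

Lemma nzmulIr p : left_injective (nzmul p).
Proof. by move=> x y z /(congr1 val)/(pmulIr (valP x)) yz; apply: val_inj. Qed.

Lemma dilate_neq0 (j : nat) x : (3 ^ j)%:Z *: val x != 0.
Proof. by rewrite scalemx_eq0 negb_or (valP x) eqz_nat expn_eq0. Qed.

Definition dilate (j : nat) x : nzvec d :=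
  exist _ ((3 ^ j)%:Z *: val x) (dilate_neq0 j x).

Lemma nzmul_dilate p j x y : nzmul p (dilate j x) y = nzmul p x (dilate j y).
Proof. by apply: val_inj; rewrite /= pmulZl pmulZr. Qed.

End NonzeroVectors.

Section MomentCurve.
Variable d : nat.

(* The factors [2 ^ t], and [3 ^ j] in [dilate j], make [dilate j (curve t)]
   determine [j] and [t] even in dimension one. *)
Definition curve_vec (t : nat) : 'rV[int]_d.+1 := \row_i (2 ^ t * t ^ i)%:Z.

Lemma curve_vec_neq0 t : curve_vec t != 0.
Proof.
apply/eqP => /rowP/(_ ord0)/eqP.
by rewrite !mxE expn0 muln1 eqz_nat expn_eq0.
Qed.

Definition curve (t : nat) : nzvec d.+1 :=
  exist _ (curve_vec t) (curve_vec_neq0 t).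

Lemma dilate_curve_inj j t j' t' :
  dilate j (curve t) = dilate j' (curve t') -> j = j' /\ t = t'.
Proof.
move=> /(congr1 val)/rowP/(_ ord0)/eqP.
rewrite !mxE !expn0 !muln1 -!PoszM eqz_nat => /eqP eq_coord.
have log2 i u : logn 2 (3 ^ i * 2 ^ u) = u.
  by rewrite lognM ?expn_gt0 // !lognX !logn_prime // muln0 muln1.
have log3 i u : logn 3 (3 ^ i * 2 ^ u) = i.
  by rewrite lognM ?expn_gt0 // !lognX !logn_prime // muln0 muln1 addn0.
split; first by rewrite -(log3 j t) eq_coord log3.
by rewrite -(log2 j t) eq_coord log2.
Qed.

Lemma curve_inj : injective curve.
Proof. by move=> t t' tt'; have [] := @dilate_curve_inj 0 t 0 t'; rewrite ?tt'. Qed.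

Definition dilated_curve (J M : nat) : seq (nzvec d.+1) :=
  [seq dilate j (curve t) | j <- iota 0 J, t <- iota 0 M].

Lemma size_dilated_curve J M : size (dilated_curve J M) = (J * M)%N.
Proof. by rewrite size_allpairs !size_iota. Qed.

Lemma dilated_curve_uniq J M : uniq (dilated_curve J M).
Proof.
apply: allpairs_uniq; rewrite ?iota_uniq // => -[j t] [j' t'] _ _ /=.
by move=> /dilate_curve_inj[-> ->].
Qed.

Lemma det_curve_neq0 (t : 'I_d.+1 -> nat) :
  injective t -> \det (\matrix_i val (curve (t i))) != 0.
Proof.
move=> t_inj; have -> : \matrix_i val (curve (t i)) =
    diag_mx (\row_i (2 ^ t i)%:Z) *m (Vandermonde d.+1 (\row_i (t i)%:Z))^T.
  apply/matrixP => i j.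
  by rewrite mul_diag_mx !mxE PoszM -[(t i ^ j)%:Z]natz natrX natz.
rewrite det_mulmx det_diag det_tr det_Vandermonde mulf_neq0 //.
  by apply/prodf_neq0 => i _; rewrite mxE eqz_nat expn_eq0.
apply/prodf_neq0 => i _; apply/prodf_neq0 => j ij.
by rewrite !mxE subr_eq0 eqz_nat (inj_eq t_inj) eq_sym neq_ltn ij.
Qed.

Lemma saturated_submod_curve (P : set 'rV[int]_d.+1) (s : seq nat) :
    saturated_submod P -> uniq s -> (d < size s)%N ->
    {in s, forall t, P (val (curve t))} ->
  forall x, P x.
Proof.
move=> satP uniq_s d_lt_s Ps.
have lt_s (i : 'I_d.+1) : (i < size s)%N by apply: leq_trans d_lt_s.
apply: (saturated_submod_full (A := \matrix_i val (curve (nth 0%N s i))) satP).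
  apply: det_curve_neq0 => i j /eqP; rewrite nth_uniq // => /eqP.
  exact: val_inj.
by move=> i; rewrite rowK; apply: Ps; apply: mem_nth.
Qed.

Lemma finite_curve_saturated_submod (P : set 'rV[int]_d.+1) :
    saturated_submod P -> ~ (forall x, P x) ->
  finite_set [set t | P (val (curve t))].
Proof.
move=> satP not_full; apply: contrapT => /(infinite_set_fset d.+1)[B BP d_lt_B].
by apply: not_full; apply: saturated_submod_curve satP (fset_uniq B) d_lt_B _ => t /BP.
Qed.

End MomentCurve.

Lemma finite_subset1 (T : Type) (A : set T) : is_subset1 A -> finite_set A.
Proof.
move=> A1; have [->|/set0P[x Ax]] := eqVneq A set0; first exact: finite_set0.
by apply: sub_finite_set (finite_set1 x) => y Ay; apply: A1.
Qed.

Lemma cofinite_forall (T I : Type) (D : set I) (P : I -> T -> Prop) :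
    finite_set D -> (forall i, D i -> cofinite_set [set t | P i t]) ->
  cofinite_set [set t | forall i, D i -> P i t].
Proof.
move=> finD finP; rewrite -[X in ~` X]/(\bigcap_(i in D) [set t | P i t]).
by rewrite setC_bigcap; apply: bigcup_finite.
Qed.

Section CommonTranslates.
Variable d : nat.
Local Notation nz := (nzvec d.+1).
Implicit Types (p q : proper_mult d.+1) (a f g y z : nz).

Definition common_translate q g0 g y z : Prop :=
  exists s, nzmul q g0 s = y /\ nzmul q g s = z.

Lemma common_translate_sym q g0 g y z :
  common_translate q g0 g y z -> common_translate q g g0 z y.
Proof. by move=> [s [? ?]]; exists s. Qed.

Lemma cofinite_not_common_translate q p g0 g f y :
  cofinite_set
    [set t | ~ common_translate q g0 g y (nzmul p f (curve d t))].
Proof.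
apply: finite_subset1 => t t' /contrapT[s [<- sE]] /contrapT[s' [/nzmulI -> s'E]].
by apply/curve_inj/(@nzmulI _ p f); rewrite -sE -s'E.
Qed.

Lemma cofinite_common_translate_ratio q p g0 g f0 f :
  cofinite_set [set t |
    common_translate q g0 g (nzmul p f0 (curve d t)) (nzmul p f (curve d t)) ->
    ratio_translation q p (val g0) (val g)].
Proof.
have [ratio|no_ratio] := pselect (ratio_translation q p (val g0) (val g)).
  by apply: sub_finite_set (finite_set0 _) => t /=; apply.
have : ~ forall x, comparable_products q p (val g0) (val g) (val f0) (val f) x.
  by move=> /(comparable_products_ratio (valP g0) (valP f0)).
move/(finite_curve_saturated_submod (comparable_products_saturated _ _ _ _ _ _)).
apply: sub_finite_set => t /= /not_implyP[[s [s0E sE]] _].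
exists 1, (val s); rewrite !scale1r; split=> //.
- by move/(congr1 val): s0E.
- by move/(congr1 val): sE.
Qed.

Lemma ratio_translation_curve_aligned q p g0 a (s : seq nat) :
    uniq s -> (d < size s)%N ->
    {in s, forall t,
      ratio_translation q p (val g0) (val (nzmul q a (curve d t)))} ->
  aligned q p.
Proof.
move=> uniq_s d_lt_s ratio_s.
have sat := ratio_translation_saturated q p (val g0).
have ratio_a := saturated_submod_curve
  (saturated_submod_preim (q (val a)) sat) uniq_s d_lt_s ratio_s.
have ratio x : ratio_translation q p (val g0) x.
  have [b [y [b_neq0 yE]]] := pmul_ldiv q x (valP a).
  by case: sat => _ _; apply; [exact: b_neq0 | rewrite -yE; exact: ratio_a].
apply: left_translations_embed_aligned (valP a) _.
exact: ratio_translation_embed (valP g0) ratio.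
Qed.

Section BasePoints.
Variables (Q : seq (proper_mult d.+1)) (G E F : seq nz) (p : proper_mult d.+1).

Definition separating : set nz :=
  [set x | forall q, q \in Q -> forall g0, g0 \in G -> forall g, g \in G ->
    forall y, y \in E -> forall f, f \in F ->
    ~ common_translate q g0 g y (nzmul p f x)].

Definition ratio_forcing : set nz :=
  [set x | forall q, q \in Q -> forall g0, g0 \in G -> forall g, g \in G ->
    forall f0, f0 \in F -> forall f, f \in F ->
    common_translate q g0 g (nzmul p f0 x) (nzmul p f x) ->
    ratio_translation q p (val g0) (val g)].

Lemma separating_ratio_forcing_neq0 : separating `&` ratio_forcing !=set0.
Proof.
suff : cofinite_set ([set t | separating (curve d t)] `&`
                     [set t | ratio_forcing (curve d t)]).
  move=> /(cofinite_set_infinite infinite_nat)/infinite_setN0[t ?].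
  by exists (curve d t).
rewrite cofinite_setI.
split; do 5![apply: cofinite_forall => [|? _]; first exact: finite_seq].
- exact: cofinite_not_common_translate.
- exact: cofinite_common_translate_ratio.
Qed.

End BasePoints.
End CommonTranslates.

Lemma exchange_count (T U : Type) (P : T -> U -> bool) (s : seq T) (t : seq U) :
  \sum_(x <- s) count (P x) t = \sum_(y <- t) count (P^~ y) s.
Proof.
under eq_bigr do rewrite -sum1_count big_mkcond.
rewrite exchange_big; apply: eq_bigr => y _.
by rewrite -sum1_count [RHS]big_mkcond.
Qed.

Lemma count_allpairs (S T U : Type) (f : S -> T -> U) (P : pred U) s t :
  count P [seq f x y | x <- s, y <- t] = \sum_(x <- s) count (P \o f x) t.
Proof.
rewrite count_flatten -map_comp sumnE big_map.
by apply: eq_bigr => x _; rewrite /= count_map.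
Qed.

Section SparseSets.
Variables (S : choiceType) (op : S -> S -> S).

Definition sparse (A : set S) : Prop :=
  forall (r : seq S) (k : nat), exists L : seq S,
    [/\ uniq L, (0 < size L)%N & forall a x, a \in r ->
      (k * count (fun f => op a (op f x) \in A) L <= size L)%N].

Lemma sparse_not_piecewise_syndetic (A : set S) :
  sparse A -> ~ piecewise_syndetic op A.
Proof.
move=> spA [r thick_r]; have [L [_ L_gt0 L_sparse]] := spA r (size r).+1.
have [x Lx] := thick_r [fset f in L].
pose hit a f := op a (op f x) \in A.
have L_hit : (size L <= \sum_(a <- r) count (hit a) L)%N.
  rewrite exchange_count -sum1_size big_seq [leqRHS]big_seq.
  apply: leq_sum => f fL; rewrite -has_count; apply/hasP.
  have [|a ar Aafx] := Lx f; first by rewrite in_fset.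
  by exists a; rewrite ?inE.
have : ((size r).+1 * size L <= size r * size L)%N.
  apply: leq_trans (leq_mul (leqnn _) L_hit) _.
  rewrite -sum1_size big_distrl big_distrr /= big_seq [leqRHS]big_seq.
  by apply: leq_sum => a ar; rewrite mul1n sum1_size L_sparse.
by rewrite leq_pmul2r // ltnn.
Qed.

Section UpperDensity.
Variable R : realType.
Hypotheses (opA : associative op) (opI : right_injective op).

Lemma sparse_density_le1 (A : set S) (c : R) (k : nat) : sparse A ->
    (forall F : {fset S}, exists s : S,
      c * #|` F|%:R
        <= #|` [fset y in [fset op f s | f in F] | y \in A]|%:R) ->
  k%:R * c <= 1.
Proof.
move=> spA dense; have [[|b ?] [_ // _ _]] := spA [::] 0%N.
have [L [uL L_gt0 L_sparse]] := spA [:: b] k.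
have [s] := dense [fset f in map (op b) L].
rewrite card_fseq undup_id ?size_map ?(map_inj_uniq (@opI b)) //.
set B := [fset y in _ | _] => cB.
have B_count : (#|` B| <= count (fun f => op b (op f s) \in A) L)%N.
  rewrite -size_filter -(size_map (fun f => op b (op f s)) [seq _ <- L | _]).
  apply: uniq_leq_size; first exact: fset_uniq.
  move=> y; rewrite !inE /=.
  move=> /andP[/imfsetP[_ /= /[!in_fset] /mapP[f fL ->] ->] Ay].
  by apply/mapP; exists f; rewrite ?mem_filter ?fL ?andbT ?opA.
have size_gt0 : 0 < (size L)%:R :> R by rewrite ltr0n.
rewrite -(ler_pM2r size_gt0) mul1r -mulrA.
apply: le_trans (ler_wpM2l (ler0n R k) cB) _.
rewrite -natrM ler_nat (leq_trans (leq_mul (leqnn k) B_count)) //.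
by rewrite L_sparse ?mem_head.
Qed.

Lemma sparse_upper_density (A : set S) : sparse A -> upper_density op R A = 0.
Proof.
move=> spA; rewrite /upper_density -[RHS]sup1; congr sup.
apply/seteqP; split=> [c /= [c_ge0 dense]|_ /= ->].
- apply/eqP; rewrite eq_le c_ge0 andbT leNgt; apply/negP => c_gt0.
  have := sparse_density_le1 (Num.bound c^-1) spA dense.
  by rewrite -ler_pdivlMr // div1r leNgt archi_boundP // invr_ge0.
- have [[|s ?] [_ // _ _]] := spA [::] 0%N.
  by split=> // F; exists s; rewrite mul0r.
Qed.

End UpperDensity.
End SparseSets.

Section FirstItems.
Variable T : countType.

Definition first_items (n : nat) : seq T := pmap pickle_inv (iota 0 n).

Lemma mem_first_items n x : (x \in first_items n) = (choice.pickle x < n)%N.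
Proof. by rewrite (can2_mem_pmap (@pickle_invK T) (@pickleK_inv T)) mem_iota. Qed.

Lemma first_items_mono m n :
  (m <= n)%N -> {subset first_items m <= first_items n}.
Proof. by move=> mn x; rewrite !mem_first_items => /leq_trans; apply. Qed.

Lemma sub_first_items (s : seq T) : exists n, {subset s <= first_items n}.
Proof.
exists (\max_(x <- s) choice.pickle x).+1 => x xs.
by rewrite mem_first_items ltnS; apply: leq_bigmax_seq.
Qed.

End FirstItems.

Section Blocks.
Variable d : nat.
Local Notation nz := (nzvec d.+1).
Local Notation pm := (proper_mult d.+1).
Variable AA : set pm.
Implicit Types (p q : pm) (E F : seq nz) (a f g s x y z : nz).

Definition stage (n : nat) : option (seq nz * pm) :=
  if pickle_inv n is Some Fp then
    if `[< AA Fp.2 >] then Some Fp else None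
  else None.

Definition base_point (n : nat) E F p : nz :=
  xget (curve d 0)
    (separating (first_items pm n) (first_items nz n) E F p `&`
     ratio_forcing (first_items pm n) (first_items nz n) F p).

Definition next_block (n : nat) E : seq nz :=
  if stage n is Some (F, p) then [seq nzmul p f (base_point n E F p) | f <- F]
  else [::].

Fixpoint blocks (n : nat) : seq nz :=
  if n is m.+1 then blocks m ++ next_block m (blocks m) else [::].

Definition block (n : nat) : seq nz := next_block n (blocks n).

Definition blocks_from (N : nat) : set nz :=
  [set y | exists2 n, (N <= n)%N & y \in block n].

Lemma stage_pickle F p : AA p -> stage (choice.pickle (F, p)) = Some (F, p).
Proof. by move=> AAp; rewrite /stage pickleK_inv /= asboolT. Qed.

Lemma stage_mem n F p : stage n = Some (F, p) -> AA p.
Proof.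
rewrite /stage; case: pickle_inv => [[F' p']|//].
by case: asboolP => // ? [_ <-].
Qed.

Lemma base_pointP n E F p :
  (separating (first_items pm n) (first_items nz n) E F p `&`
   ratio_forcing (first_items pm n) (first_items nz n) F p) (base_point n E F p).
Proof. exact: xgetPex (separating_ratio_forcing_neq0 _ _ _ _ _). Qed.

Lemma blocks_from_thick p : AA p -> thick (nzmul p) (blocks_from 0).
Proof.
move=> AAp F; pose n := choice.pickle (enum_fset F, p).
exists (base_point n (blocks n) F p) => f fF; exists n => //.
by rewrite /block /next_block stage_pickle //; apply: map_f.
Qed.

Lemma sub_block_blocks m n : (m < n)%N -> {subset block m <= blocks n}.
Proof.
elim: n => // n IHn; rewrite ltnS leq_eqVlt => /orP[/eqP->|/IHn mn] y ym.
  by rewrite /= mem_cat ym orbT.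
by rewrite /= mem_cat mn.
Qed.

Lemma blocks_from0_split N y :
  y \in blocks_from 0 -> (y \in blocks N) || (y \in blocks_from N).
Proof.
move=> /set_mem[n _ yn]; have [Nn|/sub_block_blocks/(_ y yn)->//] := leqP N n.
by apply/orP; right; rewrite inE; exists n.
Qed.

Lemma blocks_block_not_common_translate N n q g0 g y z :
    q \in first_items pm N -> g0 \in first_items nz N ->
    g \in first_items nz N -> (N <= n)%N ->
    y \in blocks n -> z \in block n ->
  ~ common_translate q g0 g y z.
Proof.
move=> qN g0N gN Nn yn; rewrite /block /next_block.
case: stage => // -[F p] /mapP[f fF ->].
have [sep _] := base_pointP n (blocks n) F p.
by apply: sep => //; apply: first_items_mono Nn _ _.
Qed.

Lemma block_common_translate_ratio n y0 : y0 \in block n ->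
  exists2 p, AA p & forall N q g0 g y z,
    q \in first_items pm N -> g0 \in first_items nz N ->
    g \in first_items nz N -> (N <= n)%N ->
    y \in block n -> z \in block n -> common_translate q g0 g y z ->
    ratio_translation q p (val g0) (val g).
Proof.
rewrite /block /next_block; case stageE : stage => [[F p]|//] _.
exists p => [|N q g0 g y z qN g0N gN Nn]; first exact: stage_mem stageE.
move=> /mapP[f0 f0F ->] /mapP[f fF ->].
have [_ force] := base_pointP n (blocks n) F p.
by apply: force => //; apply: first_items_mono Nn _ _.
Qed.

Lemma common_translate_same_block N m n q g0 g y z :
    q \in first_items pm N -> g0 \in first_items nz N ->
    g \in first_items nz N -> (N <= m)%N -> (N <= n)%N ->
    y \in block m -> z \in block n ->
  common_translate q g0 g y z -> m = n.
Proof.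
move=> qN g0N gN Nm Nn ym zn yz; case: (ltngtP m n) => // [mn|nm].
- have yn := sub_block_blocks mn ym.
  by case: (blocks_block_not_common_translate qN g0N gN Nn yn zn yz).
- have zm := sub_block_blocks nm zn; have zy := common_translate_sym yz.
  by case: (blocks_block_not_common_translate qN gN g0N Nm zm ym zy).
Qed.

Lemma blocks_from_ratio q N g0 s :
    q \in first_items pm N -> g0 \in first_items nz N ->
    blocks_from N (nzmul q g0 s) ->
  exists2 p, AA p & forall g, g \in first_items nz N ->
    blocks_from N (nzmul q g s) -> ratio_translation q p (val g0) (val g).
Proof.
move=> qN g0N [n Nn yn]; have [p AAp ratio] := block_common_translate_ratio yn.
exists p => // g gN [m Nm zm].
have yz : common_translate q g0 g (nzmul q g0 s) (nzmul q g s) by exists s.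
have nm := common_translate_same_block qN g0N gN Nn Nm yn zm yz.
by rewrite -nm in zm; apply: ratio qN g0N gN Nn yn zm yz.
Qed.

Lemma count_blocks_from_curve q N M a s :
    (forall p, AA p -> ~ aligned q p) -> q \in first_items pm N ->
    (forall t, (t < M)%N -> nzmul q a (curve d t) \in first_items nz N) ->
  (count (fun t => nzmul q (nzmul q a (curve d t)) s \in blocks_from N)
     (iota 0 M) <= d)%N.
Proof.
move=> not_aligned qN aN; rewrite leqNgt; apply/negP.
rewrite -size_filter; set l := [seq _ <- _ | _] => d_lt_l.
have late_l t : t \in l -> nzmul q a (curve d t) \in first_items nz N /\
    blocks_from N (nzmul q (nzmul q a (curve d t)) s).
  by rewrite mem_filter mem_iota => /andP[/set_mem hit tM]; split=> //; apply: aN.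
have [t0 /late_l[t0N t0l]] : exists t, t \in l.
  by case: l d_lt_l {late_l} => // t l' _; exists t; apply: mem_head.
have [p AAp ratio] := blocks_from_ratio qN t0N t0l.
have uniq_l : uniq l by rewrite filter_uniq ?iota_uniq.
have ratio_l t : t \in l -> ratio_translation q p
    (val (nzmul q a (curve d t0))) (val (nzmul q a (curve d t))).
  by move=> /late_l[tN tl]; apply: ratio.
exact: not_aligned AAp (ratio_translation_curve_aligned uniq_l d_lt_l ratio_l).
Qed.

Lemma count_blocks_from0_dilated_curve q N J M a x :
    (forall p, AA p -> ~ aligned q p) -> q \in first_items pm N ->
    (forall t, (t < M)%N -> nzmul q a (curve d t) \in first_items nz N) ->
  (count (fun f => nzmul q a (nzmul q f x) \in blocks_from 0)
     (dilated_curve d J M) <= size (blocks N) + J * d)%N.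
Proof.
move=> not_aligned qN aN; pose hit f := nzmul q a (nzmul q f x).
set L := dilated_curve d J M.
have early_hits : (count (fun f => hit f \in blocks N) L <= size (blocks N))%N.
  have hit_inj : injective hit by move=> f f' /nzmulI/nzmulIr.
  rewrite -size_filter -(size_map hit).
  apply: uniq_leq_size => [|_ /mapP[f + ->]]; last by rewrite mem_filter => /andP[].
  by rewrite map_inj_uniq // filter_uniq // dilated_curve_uniq.
have late_hits : (count (fun f => hit f \in blocks_from N) L <= J * d)%N.
  rewrite count_allpairs -{2}(size_iota 0 J) -sum1_size big_distrl /=.
  apply: leq_sum => j _; rewrite mul1n.
  apply: leq_trans (count_blocks_from_curve (dilate j x) not_aligned qN aN).
  by apply: sub_count => t; rewrite /hit /= nzmul_dilate nzmulA.
apply: leq_trans (leq_add early_hits late_hits).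
rewrite -count_predUI; apply: leq_trans (leq_addr _ _).
by apply: sub_count => f; apply: blocks_from0_split.
Qed.

Lemma sparse_blocks_from0 q :
  (forall p, AA p -> ~ aligned q p) -> sparse (nzmul q) (blocks_from 0).
Proof.
move=> not_aligned r k; pose M := (k * d.+1).+1.
have [N1 qN1] := sub_first_items [:: q].
have [N2 aN2] :=
  sub_first_items [seq nzmul q a (curve d t) | a <- r, t <- iota 0 M].
pose N := maxn N1 N2; pose J := (size (blocks N)).+1.
exists (dilated_curve d J M); rewrite size_dilated_curve dilated_curve_uniq.
split=> // a x ar.
have qN : q \in first_items pm N.
  by apply: (first_items_mono (leq_maxl _ _)); apply: qN1; apply: mem_head.
have aN t : (t < M)%N -> nzmul q a (curve d t) \in first_items nz N.
  move=> tM; apply: (first_items_mono (leq_maxr _ _)); apply: aN2.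
  by apply: allpairs_f; rewrite ?mem_iota.
have hits := count_blocks_from0_dilated_curve J x not_aligned qN aN.
have {}hits := leq_trans hits (leq_add (leqnSn _) (leqnn (J * d))).
by rewrite (leq_trans (leq_mul (leqnn k) hits)) // -mulnS mulnCA leq_mul.
Qed.

End Blocks.

Theorem theorem5p9 (R : realType) (d : nat) (d_gt0 : (0 < d)%N)
    (AA : set (proper_mult d)) :
  exists A : set (nzvec d),
    (forall p : proper_mult d, AA p -> thick (nzmul p) A) /\
    (forall q : proper_mult d, (forall p : proper_mult d, AA p -> ~ aligned q p) ->
       ~ piecewise_syndetic (nzmul q) A /\
       (left_amenable (nzmul q) R -> upper_density (nzmul q) R A = 0)).
Proof.
case: d d_gt0 AA => // d _ AA; exists (blocks_from AA 0).
split=> [p|q not_aligned]; first exact: blocks_from_thick.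
have sparse_A := sparse_blocks_from0 not_aligned.
split=> [|_]; first exact: sparse_not_piecewise_syndetic sparse_A.
by apply: sparse_upper_density => //; [apply: nzmulA | apply: nzmulI].
Qed.
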